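(* Let $p$ be a prime and let $J_p$ be the ring of $p$-adic integers. Let $(\xi_n)_{n<\omega}$ be a countable sequence of independent $J_p$-valued random variables such that $\mathbb{P}[\xi_n=\lambda]=0$ for every $n<\omega$ and every $\lambda\in J_p$. Then almost surely the set $\mathcal{M}=\{\xi_n \mid n<\omega\}$ is algebraically independent; that is, with probability $1$, for every $k\ge 1$, all pairwise distinct indices $n_1,\dots,n_k$, and every non-zero polynomial $f\in\mathbb{Z}[x_1,\dots,x_k]$, one has $f(\xi_{n_1},\dots,\xi_{n_k})\neq 0$.
   Context: $J_p$ carries its Borel $\sigma$-algebra for the $p$-adic topology. Algebraic independence is over $\mathbb{Z}$ (equivalently over $\mathbb{Q}$). ''Almost surely'' means with probability $1$. *)

(* Defs.v *)
From HB Require Import structures.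
From mathcomp Require Import all_boot all_order all_algebra.
From mathcomp Require Import all_classical all_reals all_analysis.
(* The notations of [mpoly] clash with those of MathComp-Analysis. *)
From mathcomp Require Import -(notations) mpoly.

Set Implicit Arguments.
Unset Strict Implicit.
Unset Printing Implicit Defensive.

Import Order.TTheory GRing.Theory Num.Theory.

Local Open Scope classical_set_scope.
Local Open Scope ring_scope.

(* J_p as the inverse limit of the rings Z/p Z <- Z/p^2 Z <- Z/p^3 Z <- ...
   The level Z/p^0 Z is left out because ['Z_1] denotes Z/2Z; for p > 1 the type
   ['Z_(p ^ n.+1)] really is Z/p^(n+1)Z.  (For p <= 1, [padic_int p] is a ring of
   no interest.) *)
Definition padic_coherent (p : nat) (x : forall n, 'Z_(p ^ n.+1)) : Prop :=
  forall n, (x n.+1 : nat)%:R = x n.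

Record padic_int (p : nat) := PadicInt {
  padic_val : forall n, 'Z_(p ^ n.+1);
  _ : `[< padic_coherent padic_val >]
}.

HB.instance Definition _ (p : nat) := [isSub for @padic_val p].
HB.instance Definition _ (p : nat) := [Choice of padic_int p by <:].

Section PadicRing.
Variable p : nat.
Implicit Types x y z : padic_int p.

Lemma padicP x n : (padic_val x n.+1 : nat)%:R = padic_val x n.
Proof. by case: x n => x /= /asboolP. Qed.

Lemma padic_ext x y : (forall n, padic_val x n = padic_val y n) -> x = y.
Proof.
by move=> xy; apply: val_inj; apply: functional_extensionality_dep => n.
Qed.

Lemma Zp_trunc_dvd n :
  ((Zp_trunc (p ^ n.+1)).+2 %| (Zp_trunc (p ^ n.+2)).+2)%N.
Proof.
case: p => [|[|q]]; first by rewrite !exp0n.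
  by rewrite !exp1n.
by rewrite !Zp_cast ?dvdn_exp2l // -[X in (X < _)%N](expn0 q.+2) ltn_exp2l.
Qed.

Let red n (a : 'Z_(p ^ n.+2)) : 'Z_(p ^ n.+1) := (a : nat)%:R.

Lemma red_nat n m : @red n (m%:R) = m%:R.
Proof.
by apply: val_inj; rewrite /red !Zp_nat /= modn_dvdm // Zp_trunc_dvd.
Qed.

Lemma redD n : {morph @red n : a b / a + b}.
Proof.
by move=> a b; rewrite -[a]natr_Zp -[b]natr_Zp -natrD !red_nat natrD.
Qed.

Lemma redM n : {morph @red n : a b / a * b}.
Proof.
by move=> a b; rewrite -[a]natr_Zp -[b]natr_Zp -natrM !red_nat natrM.
Qed.

Lemma red0 n : @red n 0 = 0. Proof. exact: (red_nat n 0). Qed.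
Lemma red1 n : @red n 1 = 1. Proof. exact: (red_nat n 1). Qed.

Lemma redN n : {morph @red n : a / - a}.
Proof. by move=> a; apply: (addrI (red a)); rewrite -redD !subrr red0. Qed.

Definition padic_zero : padic_int p.
Proof. by exists (fun n => 0); apply/asboolP => n; exact: red0. Defined.

Definition padic_one : padic_int p.
Proof. by exists (fun n => 1); apply/asboolP => n; exact: red1. Defined.

Definition padic_opp x : padic_int p.
Proof.
exists (fun n => - padic_val x n); apply/asboolP => n.
by rewrite [LHS]redN; congr (- _); exact: padicP.
Defined.

Definition padic_add x y : padic_int p.
Proof.
exists (fun n => padic_val x n + padic_val y n); apply/asboolP => n.
by rewrite [LHS]redD; congr (_ + _); exact: padicP.
Defined.

Definition padic_mul x y : padic_int p.
Proof.
exists (fun n => padic_val x n * padic_val y n); apply/asboolP => n.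
by rewrite [LHS]redM; congr (_ * _); exact: padicP.
Defined.

Lemma padic_addA : associative padic_add.
Proof. by move=> x y z; apply: padic_ext => n /=; rewrite addrA. Qed.

Lemma padic_addC : commutative padic_add.
Proof. by move=> x y; apply: padic_ext => n /=; rewrite addrC. Qed.

Lemma padic_add0 : left_id padic_zero padic_add.
Proof. by move=> x; apply: padic_ext => n /=; rewrite add0r. Qed.

Lemma padic_addN : left_inverse padic_zero padic_opp padic_add.
Proof. by move=> x; apply: padic_ext => n /=; rewrite addNr. Qed.

HB.instance Definition _ := GRing.isZmodule.Build (padic_int p)
  padic_addA padic_addC padic_add0 padic_addN.

Lemma padic_mulA : associative padic_mul.
Proof. by move=> x y z; apply: padic_ext => n /=; rewrite mulrA. Qed.

Lemma padic_mulC : commutative padic_mul.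
Proof. by move=> x y; apply: padic_ext => n /=; rewrite mulrC. Qed.

Lemma padic_mul1 : left_id padic_one padic_mul.
Proof. by move=> x; apply: padic_ext => n /=; rewrite mul1r. Qed.

Lemma padic_mulD : left_distributive padic_mul padic_add.
Proof. by move=> x y z; apply: padic_ext => n /=; rewrite mulrDl. Qed.

Lemma padic_one_neq0 : padic_one != 0.
Proof.
apply/eqP => /(congr1 (fun x : padic_int p => padic_val x 0)) /=.
by apply/eqP; exact: oner_neq0.
Qed.

HB.instance Definition _ := GRing.Zmodule_isComNzRing.Build (padic_int p)
  padic_mulA padic_mulC padic_mul1 padic_mulD padic_one_neq0.

HB.instance Definition _ := isPointed.Build (padic_int p) 0.

(* The p-adic topology: the cosets x + p^n J_p form a neighbourhood basis at x. *)
Definition padic_ball x (n : nat) : set (padic_int p) :=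
  [set x + p%:R ^+ n * z | z in [set: padic_int p]].

Definition padic_nbhs x : set_system (padic_int p) :=
  filter_from [set: nat] (padic_ball x).

HB.instance Definition _ := hasNbhs.Build (padic_int p) padic_nbhs.

Lemma padic_ballxx x n : padic_ball x n x.
Proof. by exists 0 => //; rewrite mulr0 addr0. Qed.

Lemma padic_ball_le x m n : (m <= n)%N -> padic_ball x n `<=` padic_ball x m.
Proof.
move=> mn _ [z _ <-]; exists (p%:R ^+ (n - m) * z) => //.
by rewrite mulrA -exprD subnKC.
Qed.

Lemma padic_ball_trans x y n : padic_ball x n y -> padic_ball y n `<=` padic_ball x n.
Proof. by move=> [z _ <-] _ [t _ <-]; exists (z + t); rewrite // mulrDr addrA. Qed.

Lemma padic_nbhs_filter x : ProperFilter (nbhs x).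
Proof.
apply: filter_from_proper; last by move=> n _; exists x; exact: padic_ballxx.
apply: filter_from_filter; first by exists 0%N.
move=> m n _ _; exists (maxn m n) => // y xy.
by split; apply: padic_ball_le xy; rewrite ?leq_maxl ?leq_maxr.
Qed.

Lemma padic_nbhs_singleton x (A : set (padic_int p)) : nbhs x A -> A x.
Proof. by move=> [n _]; apply; exact: padic_ballxx. Qed.

Lemma padic_nbhs_nbhs x (A : set (padic_int p)) : nbhs x A -> nbhs x (nbhs^~ A).
Proof.
move=> [n _ xA]; exists n => // y xy; exists n => //.
exact: subset_trans (padic_ball_trans xy) xA.
Qed.

HB.instance Definition _ := Nbhs_isNbhsTopological.Build (padic_int p)
  padic_nbhs_filter padic_nbhs_singleton padic_nbhs_nbhs.

(* The Borel sigma-algebra of the p-adic topology. *)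
HB.instance Definition _ := Measurable.copy (padic_int p)
  (g_sigma_algebraType (@open (padic_int p))).

End PadicRing.

(* Mutual independence of a family of random variables: the product rule for every
   finite set [s] of (pairwise distinct) indices. *)
Definition mutually_independent d (T : measurableType d) (R : realType)
    (P : probability T R) d' (E : measurableType d') (I : eqType)
    (X : I -> {RV P >-> E}) : Prop :=
  forall (s : seq I) (A : I -> set E), uniq s -> (forall i, measurable (A i)) ->
    P (\bigcap_(i in [set` s]) (X i @^-1` A i)) =
    (\prod_(i <- s) P (X i @^-1` A i))%E.

Definition int_mpoly_eval (S : comNzRingType) (k : nat)
    (f : mpoly k int) (v : 'I_k -> S) : S :=
  mmap (fun c : int => c%:~R) v f.

(* Algebraic independence over Z of a family.  Indices, not values, are required to
   be pairwise distinct, so such a family is in particular injective. *)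
Definition algebraically_independent (S : comNzRingType) (I : Type) (x : I -> S) : Prop :=
  forall (k : nat) (i : 'I_k -> I) (f : mpoly k int),
    (1 <= k)%N -> injective i -> f != 0 ->
    int_mpoly_eval f (fun j => x (i j)) != 0.

(* Main.v *)
(* By countability it suffices that a non-zero polynomial f almost surely does not
   vanish at (xi_(i_1), ..., xi_(i_k)).  Induct on k: write f as a polynomial in its
   last variable whose coefficients are polynomials in the others.  By induction its
   leading coefficient is almost surely non-zero at (xi_(i_1), ..., xi_(i_(k-1))), and
   then, J_p being a domain, f has finitely many roots in the last variable.  As
   xi_(i_k) is independent of the other variables and atomless, Fubini's theorem
   concludes. *)
From HB Require Import structures.
Require Import Defs.
From mathcomp Require Import all_boot all_order all_algebra.
From mathcomp Require Import all_classical all_reals all_analysis.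
From mathcomp Require Import -(notations) mpoly.

Set Implicit Arguments.
Unset Strict Implicit.
Unset Printing Implicit Defensive.

Import Order.TTheory GRing.Theory Num.Theory.

Local Open Scope classical_set_scope.
Local Open Scope ring_scope.

(** * Finiteness of the set of roots over a domain *)

(** Dividing by ['X - a] for a root [a] lowers the degree. Absence of zero divisors is a hypothesis
    because [padic_int p] is declared only as a commutative ring. *)
Lemma poly_roots_seq (A : comNzRingType) :
    (forall x y : A, x * y = 0 -> x = 0 \/ y = 0) ->
  forall q : {poly A}, q != 0 -> exists s : seq A, forall x, root q x -> x \in s.
Proof.
move=> Adom q; elim: (size q) {-2}q (leqnn (size q)) => {q} [|n IHn] q.
  by rewrite leqn0 size_poly_eq0 => ->.
move=> sq q0; have [[a ra]|] := pselect (exists a, root q a); last first.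
  by move=> nr; exists [::] => x rx; case: nr; exists x.
have [q' qE] := factor_theorem _ _ ra.
have q'0 : q' != 0 by apply: contraNneq q0 => q'0; rewrite qE q'0 mul0r.
have [|s sP] := IHn q' _ q'0.
  by move: sq; rewrite qE size_Mmonic ?monicXsubC// size_XsubC addn2.
exists (a :: s) => x.
rewrite qE /root hornerM hornerXsubC => /eqP /Adom[/eqP rx|/eqP].
  by rewrite in_cons sP ?orbT.
by rewrite subr_eq0 => /eqP->; rewrite mem_head.
Qed.

(** * J_p is a domain of characteristic zero *)

Section padic_arithmetic.
Variables (p : nat) (p_prime : prime p).
Implicit Types x y : padic_int p.

Let pn_gt1 n : (1 < p ^ n.+1)%N.
Proof. by rewrite -[1%N](expn0 p) ltn_exp2l ?prime_gt1. Qed.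

Lemma padic_val_lt x n : (padic_val x n < p ^ n.+1)%N.
Proof. by have := ltn_ord (padic_val x n); rewrite [X in (_ < X)%N]Zp_cast. Qed.

Lemma padic_val_modn x m n : (m <= n)%N ->
  (padic_val x n %% p ^ m.+1)%N = padic_val x m.
Proof.
elim: n => [|n IHn].
  by rewrite leqn0 => /eqP->; rewrite modn_small// padic_val_lt.
rewrite leq_eqVlt => /predU1P[->|mn].
  by rewrite modn_small// padic_val_lt.
by rewrite -IHn// -(padicP x n) val_Zp_nat// modn_dvdm// dvdn_exp2l.
Qed.

Lemma padic_val_eq0 x m n : (m <= n)%N ->
  (padic_val x m == 0) = (p ^ m.+1 %| padic_val x n)%N.
Proof. by move=> mn; rewrite /dvdn padic_val_modn. Qed.

Lemma padic_neq0 x : x <> 0 -> exists n, padic_val x n != 0.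
Proof.
move=> x0; apply: contrapT => H; apply: x0; apply: padic_ext => n.
by apply/eqP/negPn/negP => xn; apply: H; exists n.
Qed.

(** If [x] and [y] are non-zero at levels [n] and [m], that is modulo [p ^ n.+1] and [p ^ m.+1],
    their valuations are at most [n] and [m]. The product then has valuation at most [n + m], so it
    is non-zero at level [N]. *)
Lemma padic_mulf_eq0 x y : x * y = 0 -> x = 0 \/ y = 0.
Proof.
move=> xy0; have [|x0] := pselect (x = 0); first by left.
have [|y0] := pselect (y = 0); [by right|exfalso].
have [n xn] := padic_neq0 x0; have [m ym] := padic_neq0 y0.
pose N := (n + m).+1.
have ndvd (z : padic_int p) k : padic_val z k != 0 -> (k <= N)%N ->
    ~~ (p ^ k.+1 %| padic_val z N)%N.
  by move=> zk kN; rewrite -padic_val_eq0.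
have nx := ndvd _ _ xn (leqW (leq_addr m n)).
have ny := ndvd _ _ ym (leqW (leq_addl n m)).
have := congr1 (fun z => padic_val z N : nat) xy0.
rewrite /= [X in (_ %% X)%N]Zp_cast// => /eqP.
have pos z k : ~~ (p ^ k %| z)%N -> (0 < z)%N by case: z => //; rewrite dvdn0.
have x_gt0 := pos _ _ nx; have y_gt0 := pos _ _ ny.
rewrite -/(dvdn _ _) pfactor_dvdn ?muln_gt0 ?x_gt0// lognM//.
move: nx ny; rewrite !pfactor_dvdn// -!ltnNge !ltnS => lx ly.
by rewrite leqNgt !ltnS (leq_trans (leq_add lx ly))// leqnSn.
Qed.

Lemma padic_val_nat k n : padic_val (k%:R : padic_int p) n = k%:R.
Proof. by elim: k => // k IHk; rewrite !mulrS -IHk. Qed.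

(** As [k < p ^ k.+1], the residue of a natural number [k] at level [k] is [k] itself. *)
Lemma padic_intr_inj (c : int) : (c%:~R : padic_int p) = 0 -> c = 0.
Proof.
have natP k : (k%:R : padic_int p) = 0 -> k = 0%N.
  move=> /(congr1 (fun z => padic_val z k : nat)); rewrite padic_val_nat.
  rewrite val_Zp_nat//= modn_small// ltnW//.
  exact/ltn_expl/prime_gt1.
case: (intP c) => // n; first by rewrite -[X in X -> _]/((n.+1)%:R = 0) => /natP.
by rewrite mulrNz => /eqP; rewrite oppr_eq0 => /eqP /natP.
Qed.

End padic_arithmetic.

(** * Measurability through residues *)

Section level_measurable.
Context (p : nat) (d : measure_display) (T : measurableType d).
Implicit Types g h : T -> padic_int p.

(* The residues of a sum or product only depend on those of the operands, so this form
   of measurability is stable under ring operations without knowing that the Borel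
   sigma-algebra is generated by the residue classes. *)
Definition level_measurable g :=
  forall n (a : 'Z_(p ^ n.+1)), measurable [set w | padic_val (g w) n = a].

Lemma level_measurable_cst c : level_measurable (fun=> c).
Proof.
move=> n a; have [<-|ca] := eqVneq (padic_val c n) a.
  by rewrite (_ : [set _ | _] = setT)//; apply/seteqP; split.
rewrite (_ : [set _ | _] = set0)//; apply/seteqP; split=> // w /= cE.
by rewrite cE eqxx in ca.
Qed.

(** The residue rings are finite, so the event is a finite union over the pairs of residues that
    [op] sends to [c]. *)
Lemma level_measurable_op g h f
    (op : forall n, 'Z_(p ^ n.+1) -> 'Z_(p ^ n.+1) -> 'Z_(p ^ n.+1)) :
    (forall w n, padic_val (f w) n =
      op n (padic_val (g w) n) (padic_val (h w) n)) ->
  level_measurable g -> level_measurable h -> level_measurable f.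
Proof.
move=> fE mg mh n c.
rewrite (_ : [set _ | _] = \bigcup_(ab in [set ab | op n ab.1 ab.2 = c])
    ([set w | padic_val (g w) n = ab.1] `&`
     [set w | padic_val (h w) n = ab.2])).
  by apply: fin_bigcup_measurable => // ab _; apply: measurableI.
apply/seteqP; split=> w /=.
  by rewrite fE => wc; exists (padic_val (g w) n, padic_val (h w) n).
by move=> [[a b] /= <- [<- <-]]; rewrite fE.
Qed.

Lemma level_measurableD g h : level_measurable g -> level_measurable h ->
  level_measurable (fun w => g w + h w).
Proof. exact: level_measurable_op. Qed.

Lemma level_measurableM g h : level_measurable g -> level_measurable h ->
  level_measurable (fun w => g w * h w).
Proof. exact: level_measurable_op. Qed.

Lemma level_measurable_sum I (r : seq I) (g : I -> T -> padic_int p) :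
    (forall i, level_measurable (g i)) ->
  level_measurable (fun w => \sum_(i <- r) g i w).
Proof.
move=> mg; elim: r => [|i r IHr].
  by under eq_fun do rewrite big_nil; exact: level_measurable_cst.
by under eq_fun do rewrite big_cons; exact: level_measurableD.
Qed.

Lemma level_measurable_prod I (r : seq I) (g : I -> T -> padic_int p) :
    (forall i, level_measurable (g i)) ->
  level_measurable (fun w => \prod_(i <- r) g i w).
Proof.
move=> mg; elim: r => [|i r IHr].
  by under eq_fun do rewrite big_nil; exact: level_measurable_cst.
by under eq_fun do rewrite big_cons; exact: level_measurableM.
Qed.

Lemma level_measurableX g k : level_measurable g ->
  level_measurable (fun w => g w ^+ k).
Proof.
move=> mg; elim: k => [|k IHk].
  by under eq_fun do rewrite expr0; exact: level_measurable_cst.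
by under eq_fun do rewrite exprS; exact: level_measurableM.
Qed.

Lemma level_measurable_eval k (f : mpoly k int) (g : 'I_k -> T -> padic_int p) :
    (forall j, level_measurable (g j)) ->
  level_measurable (fun w => int_mpoly_eval f (fun j => g j w)).
Proof.
move=> mg; apply: level_measurable_sum => m.
apply: level_measurableM; first exact: level_measurable_cst.
by apply: level_measurable_prod => j; exact: level_measurableX.
Qed.

Lemma level_measurable_eq0 g : level_measurable g -> measurable [set w | g w = 0].
Proof.
move=> mg; rewrite (_ : [set _ | _] =
    \bigcap_n [set w | padic_val (g w) n = 0]).
  exact: bigcapT_measurable.
apply/seteqP; split=> w /=; first by move=> gw n _; rewrite /= gw.
by move=> gw; apply: padic_ext => n; exact: gw.
Qed.

(** A residue class modulo [p ^ n.+1] contains the ball of index [n.+1] around each of its points;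
    it is therefore open, hence Borel. *)
Lemma measurable_level_measurable g : prime p ->
  measurable_fun setT g -> level_measurable g.
Proof.
move=> p_prime mg n a.
rewrite -[X in measurable X]/(g @^-1` [set x | padic_val x n = a]).
rewrite -[X in measurable X]setTI; apply: mg => //.
apply: (@sub_sigma_algebra _ setT (@open (padic_int p))).
rewrite openE => x /= xa; exists n.+1 => // _ [z _ <-] /=.
rewrite -[RHS]xa -[RHS]addr0; congr (_ + _); apply/val_inj.
have pn1 : (1 < p ^ n.+1)%N by rewrite -[1%N](expn0 p) ltn_exp2l ?prime_gt1.
have -> : padic_val (p%:R ^+ n.+1 : padic_int p) n = 0.
  rewrite -(natrX (padic_int p)) padic_val_nat.
  by apply/val_inj; rewrite /= val_Zp_nat//= modnn.
by rewrite mul0r.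
Qed.

End level_measurable.

Lemma level_measurable_comp p d d' (T : measurableType d) (T' : measurableType d')
    (g : T -> padic_int p) (h : T' -> T) :
  level_measurable g -> measurable_fun setT h -> level_measurable (g \o h).
Proof.
move=> mg mh n a; rewrite -[X in measurable X]setTI.
by have := mh measurableT _ (mg n a).
Qed.

(** * Independence from a sigma-algebra and Fubini's theorem *)

Section independent_fibers.
Context d (T : measurableType d) (R : realType) (P : probability T R).
Context d' (E : measurableType d') (X : {RV P >-> E}) (G : set (set T)).
Hypotheses (Gm : G `<=` measurable) (GT : G setT) (GI : setI_closed G).
Hypothesis GX : forall A B, G A -> measurable B ->
  P (A `&` X @^-1` B) = (P A * P (X @^-1` B))%E.

(** For fixed [B] both sides are finite measures in [A] that agree on the pi-system [G], hence on
    the sigma-algebra it generates. *)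
Lemma sigma_algebra_indep A B : <<s G >> A -> measurable B ->
  P (A `&` X @^-1` B) = (P A * P (X @^-1` B))%E.
Proof.
move=> GA mB.
have mXB : measurable (X @^-1` B).
  by rewrite -[X in measurable X]setTI; exact: measurable_funP.
have PXB : P (X @^-1` B) \is a fin_num by exact: fin_num_measure.
pose c : {nonneg R} := NngNum (fine_ge0 (measure_ge0 P (X @^-1` B))).
have cE : (c%:num)%:E = P (X @^-1` B) by rewrite -[RHS]fineK.
rewrite -cE muleC -[LHS]/(mrestr P mXB A) -[RHS]/(mscale c P A).
apply: (g_sigma_algebra_measure_unique G Gm (fun=> setT)) => //.
- by rewrite bigcup_const.
- by move=> C GC; rewrite /= /mrestr /mscale cE muleC GX.
- move=> _; rewrite /= /mrestr setTI.
  exact: le_lt_trans (probability_le1 P mXB) (ltry 1).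
Qed.

Let TG : measurableType _ := g_sigma_algebraType G.

Let sGm : <<s G >> `<=` measurable.
Proof. exact: (smallest_sub (@sigma_algebra_measurable _ T) Gm). Qed.

(** As a random variable into the coarser space [TG], the identity has for law the restriction of
    [P] to [<<s G >>]. *)
Let idG (w : T) : TG := w.

Let midG : measurable_fun setT idG.
Proof. by move=> _ B mB; rewrite setTI; exact: sGm. Qed.

HB.instance Definition _ := isMeasurableFun.Build _ _ _ _ idG midG.

Let pairX (w : T) : (TG * E)%type := (idG w, X w).

Let mpairX : measurable_fun setT pairX.
Proof. by apply: measurable_fun_pair => //; exact: measurable_funP. Qed.

HB.instance Definition _ := isMeasurableFun.Build _ _ _ _ pairX mpairX.

(* By independence, the joint law of the identity of [(T, <<s G >>)] and [X] is a
   product measure. *)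
Lemma null_independent_fibers (S : set (TG * E)) (N : set T) :
    measurable S -> <<s G >> N -> P N = 0%E ->
    (forall w, ~ N w -> P (X @^-1` xsection S w) = 0%E) ->
  P [set w | S (w : TG, X w)] = 0%E.
Proof.
move=> mS GN PN0 fib0.
have prodE := @product_measure_unique _ _ _ _ _ (distribution P idG)
  (distribution P X) (distribution P pairX) _ S mS.
rewrite [LHS](_ : _ = distribution P pairX S)// -prodE; last first.
  by move=> A B mA mB; rewrite /distribution /pushforward -sigma_algebra_indep.
have mNG : measurable (N : set TG) by [].
(* The product measure of [S] is the integral of the measures of its fibres; the null set [N] is
   discarded, and the integrand vanishes elsewhere. *)
rewrite [LHS](ge0_negligible_integral (mu := distribution P idG) mNG)//=.
- by apply: integral0_eq => w [_ nNw]; exact: fib0.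
- exact: measurable_fun_xsection.
Qed.

End independent_fibers.

(** * Null sets and almost sure events *)

Lemma negligible_seq d (T : measurableType d) (R : realType)
    (P : {measure set T -> \bar R}) (I : choiceType) (F : I -> set T) (s : seq I) :
  (forall i, P.-negligible (F i)) -> P.-negligible (\bigcup_(i in [set` s]) F i).
Proof.
move=> F0; rewrite bigcup_seq; elim/big_ind : _ => //.
  exact: negligible_set0.
exact: negligibleU.
Qed.

Section almost_sure.
Context d (T : measurableType d) (R : realType) (P : probability T R).

(** Measurability is included since the theorem asserts it of the final event. *)
Definition almost_sure (A : set T) := measurable A /\ P A = 1%E.

Lemma almost_sureT : almost_sure setT.
Proof. by split=> //; exact: probability_setT. Qed.

Lemma almost_sureC A : measurable A -> P A = 0%E -> almost_sure (~` A).
Proof.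
by move=> mA PA; split; [exact: measurableC|rewrite probability_setC// PA sube0].
Qed.

(** Handles premises that do not depend on the outcome: if [Q] fails, the event is all of [T]. *)
Lemma almost_sure_imp (Q : Prop) (A : set T) :
  (Q -> almost_sure A) -> almost_sure [set w | Q -> A w].
Proof.
move=> QA; have [q|nq] := pselect Q.
  rewrite (_ : [set _ | _] = A); first exact: QA.
  by apply/seteqP; split=> w //=; exact.
rewrite (_ : [set _ | _] = setT); first exact: almost_sureT.
by apply/seteqP; split=> w //= _ /nq.
Qed.

Lemma almost_sure_forall_nat (A : nat -> set T) :
  (forall n, almost_sure (A n)) -> almost_sure (\bigcap_n A n).
Proof.
move=> asA; have mA : measurable (\bigcap_n A n).
  by apply: bigcapT_measurable => n; have [] := asA n.
have P0 : P (~` \bigcap_n A n) = 0%E.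
  apply: (measure_negligible (measurableC mA)).
  rewrite setC_bigcap; apply: negligible_bigcup => n.
  have [mAn An1] := asA n; apply/negligibleP; first exact: measurableC.
  by apply: etrans (probability_setC P mAn) _; rewrite An1 subee.
by rewrite -[X in almost_sure X]setCK; apply: almost_sureC => //; exact: measurableC.
Qed.

(** The intersection is reindexed by codes: the event at [n] is [A i] when [e i = n], and all of [T]
    when [n] codes nothing. Passing [e] explicitly allows function types such as ['I_k -> nat] for
    [I]. *)
Lemma almost_sure_forall (I : Type) (e : I -> nat) (A : I -> set T) :
    injective e -> (forall i, almost_sure (A i)) ->
  almost_sure [set w | forall i, A i w].
Proof.
move=> e_inj asA.
rewrite (_ : [set _ | _] = \bigcap_n [set w | forall i, e i = n -> A i w]).
  apply: almost_sure_forall_nat => n.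
  have [[i ein]|nei] := pselect (exists i, e i = n).
    rewrite (_ : [set _ | _] = A i); first exact: asA.
    apply/seteqP; split=> w /=; first exact.
    by move=> Aw j ejn; have -> : j = i by apply: e_inj; rewrite ein.
  rewrite (_ : [set _ | _] = setT); first exact: almost_sureT.
  by apply/seteqP; split=> w //= _ i ein; case: nei; exists i.
by apply/seteqP; split=> w /= Aw; [move=> n _ i _|move=> i; apply: (Aw (e i))].
Qed.

End almost_sure.

(** * Multivariate polynomials: splitting off the last variable, and countability *)

Lemma neq_ord_max n (i : 'I_n.+1) :
  i != ord_max -> exists j, i = widen_ord (leqnSn n) j.
Proof.
move=> i_max; have i_ltn : (i < n)%N by rewrite ltn_neqAle -ltnS ltn_ord andbT.
by exists (Ordinal i_ltn); apply/val_inj.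
Qed.

(** A monomial [m] is determined by its last exponent and by [low m], its other exponents, so every
    coefficient of [f] can be read off from [muni f]. *)
Lemma muni_eq0 n (A : nzRingType) (f : mpoly n.+1 A) :
  muni f = 0 -> f = 0.
Proof.
pose low (m : multinom n.+1) : multinom n :=
  Multinom [tuple fun_of_multinom m (widen_ord (leqnSn n) i) | i < n].
move=> f0; apply/mpolyP => m; rewrite mcoeff0.
have [mf|] := boolP (m \in msupp f); last exact: memN_msupp_eq0.
have := congr1 (fun q : {poly mpoly n A} =>
  mcoeff (low m) q`_(fun_of_multinom m ord_max)) f0.
rewrite muniE coef0 mcoeff0 coef_sum raddf_sum /=.
rewrite (bigD1_seq m)//= ?msupp_uniq// big1_seq; last first.
  move=> m' /andP[m'm _]; rewrite coefZ coefXn.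
  have [mm|] := eqVneq; last by rewrite mulr0 mcoeff0.
  rewrite mulr1 mcoeffZ mcoeffX.
  case: eqP => [lowE|]; last by rewrite mulr0.
  case/eqP: m'm; apply/mnmP => i.
  have [->|/neq_ord_max[j ->]] := eqVneq i ord_max; first exact: esym.
  have := congr1 (fun u => fun_of_multinom u j) lowE.
  by rewrite !mnmE.
by rewrite coefZ coefXn eqxx mulr1 mcoeffZ mcoeffX eqxx mulr1 addr0.
Qed.

Lemma int_mpoly_eval_muni (A : comNzRingType) k (f : mpoly k.+1 int)
    (v : 'I_k.+1 -> A) :
  int_mpoly_eval f v =
  (map_poly (fun g => int_mpoly_eval g (fun j => v (widen_ord (leqnSn k) j)))
    (muni f)).[v ord_max].
Proof.
pose u := fun j => v (widen_ord (leqnSn k) j).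
(* Evaluation of the coefficients is recast as a ring morphism, so that [map_poly] becomes additive
   and multiplicative. *)
pose ev : {rmorphism mpoly k int -> A} := mmap intr u.
rewrite -[X in map_poly X]/(ev : _ -> _) muniE raddf_sum horner_sum.
apply: eq_bigr => m _ /=.
rewrite map_polyZ map_polyXn hornerZ hornerXn /= mmapZ mmapX.
rewrite /mmap1 big_ord_recr /= mulrA; congr (_ * _ * _).
by apply: eq_bigr => i _; rewrite mnmE.
Qed.

(** Encodes a polynomial by finite data: the first components recover the support, the second ones
    the coefficients. *)
Lemma mpoly_graph_inj n (A : nzRingType) :
  injective (fun f : mpoly n A => [seq (m, mcoeff m f) | m <- msupp f]).
Proof.
have graph_msupp (h : mpoly n A) :
    unzip1 [seq (m, mcoeff m h) | m <- msupp h] = msupp h.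
  by rewrite /unzip1 -map_comp map_id_in.
move=> f g fg; have fgs : msupp f = msupp g by rewrite -graph_msupp fg graph_msupp.
apply/mpolyP => m; have [mf|mf] := boolP (m \in msupp f); last first.
  by rewrite !memN_msupp_eq0// -fgs.
by move: fg; rewrite -fgs => /eq_in_map /(_ m mf)[].
Qed.

(** * Vanishing of one polynomial at independent atomless variables *)

Section independent_padics.
Context (p : nat) (p_prime : prime p) (d : measure_display)
  (T : measurableType d) (R : realType) (P : probability T R)
  (xi : nat -> {RV P >-> padic_int p}).
Hypothesis xi_indep : mutually_independent xi.
Hypothesis xi_atomless : forall n lambda, P (xi n @^-1` [set lambda]) = 0%E.

Let measurable_xi n B : measurable B -> measurable (xi n @^-1` B).
Proof. by move=> mB; rewrite -[X in measurable X]setTI; exact: measurable_funP. Qed.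

(** A pi-system generating the sigma-algebra of the variables with index in [s]. *)
Definition cylinders (s : seq nat) : set (set T) :=
  [set \bigcap_(j in [set` s]) xi j @^-1` A j |
    A in [set A : nat -> set (padic_int p) | forall j, measurable (A j)]].

Lemma cylinders_measurable s : cylinders s `<=` measurable.
Proof.
move=> _ [A mA <-]; apply: fin_bigcap_measurable; first exact: finite_seq.
by move=> j _; exact: measurable_xi.
Qed.

Lemma cylindersT s : cylinders s setT.
Proof. by exists (fun=> setT) => //; rewrite bigcapT. Qed.

Lemma cylindersI s : setI_closed (cylinders s).
Proof.
move=> _ _ [A mA <-] [B mB <-]; exists (fun j => A j `&` B j).
  by move=> j; exact: measurableI.
by rewrite -bigcapI.
Qed.

Lemma cylinders_indep s n A B : uniq (n :: s) -> cylinders s A -> measurable B ->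
  P (A `&` xi n @^-1` B) = (P A * P (xi n @^-1` B))%E.
Proof.
(* As [n] is not in [s], [F'] describes the same cylinder over [s], while over [n :: s] it adds the
   factor [B]; the product rule is applied to both lists. *)
move=> uns [F mF <-] mB; pose F' j := if j == n then B else F j.
have /andP[ns us] := uns.
have F'E j : j \in s -> F' j = F j.
  by rewrite /F'; case: eqP => // -> sn; rewrite sn in ns.
have mF' j : measurable (F' j) by rewrite /F'; case: ifP.
have F'n : F' n = B by rewrite /F' eqxx.
rewrite (_ : P (\bigcap_(j in _) _) = (\prod_(j <- s) P (xi j @^-1` F' j))%E).
  rewrite muleC -F'n.
  have := xi_indep uns mF'; rewrite big_cons => <-; congr (P _).
  apply/seteqP; split=> w /=.
    move=> [sw nw] j /=; rewrite in_cons => /predU1P[->//|js].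
    by rewrite F'E//; exact: sw.
  move=> nsw; split; last by apply: nsw; rewrite /= mem_head.
  by move=> j /= js; rewrite -F'E//; apply: nsw; rewrite /= in_cons js orbT.
rewrite -(xi_indep us mF'); congr (P _).
by apply: eq_bigcapr => j /= js; rewrite F'E.
Qed.

Lemma cylinders_xi s n : n \in s ->
  level_measurable (T := g_sigma_algebraType (cylinders s)) (xi n).
Proof.
move=> ns; apply: measurable_level_measurable => // _ B mB.
rewrite setTI; apply: sub_gen_smallest.
exists (fun j => if j == n then B else setT); first by move=> j; case: ifP.
apply/seteqP; split=> [w /(_ n ns) /=|w Bw j _ /=]; first by rewrite eqxx.
by case: eqP => // ->.
Qed.

Lemma null_root_set n (q : {poly padic_int p}) : q != 0 ->
  measurable [set y | root q y] -> P (xi n @^-1` [set y | root q y]) = 0%E.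
Proof.
move=> q0 mq; apply: measure_negligible; first exact: measurable_xi.
have [s sP] := poly_roots_seq (padic_mulf_eq0 p_prime) q0.
apply: negligibleS (negligible_seq (F := fun y => xi n @^-1` [set y]) s _).
  by move=> w /sP ws; exists (xi n w).
move=> y; apply/negligibleP; last exact: xi_atomless.
(* Points are Borel, as zero sets of level-measurable maps. *)
apply: measurable_xi; rewrite (_ : [set y] = [set x | x - y = 0]).
  apply: level_measurable_eq0; apply: level_measurableD.
    exact: measurable_level_measurable.
  exact: level_measurable_cst.
by apply/seteqP; split=> x /=; [move=> ->; rewrite subrr|move/subr0_eq].
Qed.

Lemma measurable_eval_eq0 k (i : 'I_k -> nat) (f : mpoly k int) :
  measurable [set w | int_mpoly_eval f (fun j => xi (i j) w) = 0].
Proof.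
apply/level_measurable_eq0/level_measurable_eval => j.
exact: measurable_level_measurable.
Qed.

Lemma null_eval k (i : 'I_k -> nat) (f : mpoly k int) :
    injective i -> f != 0 ->
  P [set w | int_mpoly_eval f (fun j => xi (i j) w) = 0] = 0%E.
Proof.
elim: k i f => [|k IHk] i f i_inj f0.
  (* Without variables [f] is a non-zero constant, which stays non-zero in J_p. *)
  rewrite (_ : [set _ | _] = set0) ?measure0//; apply/seteqP; split=> // w /=.
  move: f0; rewrite (nvar0_mpolyC f); set c := mcoeff _ _.
  rewrite [int_mpoly_eval _ _]mmapC => c0 /(padic_intr_inj p_prime) cE.
  by rewrite cE mpolyC0 eqxx in c0.
pose widen := widen_ord (leqnSn k).
pose s := codom (i \o widen); pose n := i ord_max.
have uns : uniq (n :: s).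
  rewrite /= map_inj_uniq ?enum_uniq ?andbT; last first.
    by move=> a b /i_inj /(congr1 val) /= /val_inj.
  apply/negP => /codomP[j /i_inj /(congr1 val) /= kj].
  by have := ltn_ord j; rewrite -kj ltnn.
pose G := cylinders s; pose TG : measurableType _ := g_sigma_algebraType G.
have xiG j : level_measurable (T := TG) (xi (i (widen j))).
  by apply: cylinders_xi; apply/codomP; exists j.
(* The last argument is decoupled from the outcome; at [(w, xi n w)] the original arguments
   return. *)
pose v (z : TG * padic_int p) j := if j == ord_max then z.2 else xi (i j) z.1.
pose S := [set z | int_mpoly_eval f (v z) = 0].
have mS : measurable S.
  apply/level_measurable_eq0/level_measurable_eval => j.
  rewrite /v; have [_|/neq_ord_max[j' ->]] := eqVneq j ord_max.
    exact: (measurable_level_measurable p_prime measurable_snd).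
  by apply: (level_measurable_comp (xiG j')); exact: measurable_fst.
pose g := lead_coef (muni f).
have g0 : g != 0 by rewrite lead_coef_eq0; apply: contra_neq f0; exact: muni_eq0.
pose N := [set w | int_mpoly_eval g (fun j => xi (i (widen j)) w) = 0].
have GN : measurable (N : set TG).
  by apply/level_measurable_eq0/level_measurable_eval => j; exact: xiG.
have PN : P N = 0%E.
  by apply: IHk g0 => a b /i_inj /(congr1 val) /= /val_inj.
rewrite (_ : [set _ | _] = [set w | S (w, xi n w)]).
  apply: (null_independent_fibers (X := xi n) (@cylinders_measurable s)
    (@cylindersT s) (@cylindersI s) _ mS GN PN).
    by move=> A B GA mB; exact: (cylinders_indep uns).
  move=> w Nw.
  pose q := map_poly
    (fun h => int_mpoly_eval h (fun j => xi (i (widen j)) w)) (muni f).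
  have evE y : int_mpoly_eval f (v (w, y)) = q.[y].
    rewrite int_mpoly_eval_muni {2}/v eqxx /q.
    congr (map_poly _ _).[_]; apply/funext => h; congr (int_mpoly_eval h _).
    apply/funext => j; rewrite /v /=; case: eqP => // /(congr1 val) /= jk.
    by have := ltn_ord j; rewrite jk ltnn.
  have SE : xsection S w = [set y | root q y].
    by apply/seteqP; split=> y; rewrite /xsection /= inE /S /= evE => /eqP.
  rewrite SE; apply: null_root_set; last first.
    by rewrite -SE; exact: measurable_xsection.
  (* The coefficient of [q] at the degree of [muni f] is the value of [g] at [w], so [q = 0] would
     put [w] in [N]. *)
  apply: contra_not_neq Nw => q0; rewrite /N /=.
  have := congr1 (fun r : {poly _} => r`_(size (muni f)).-1) q0.
  by rewrite coef_map coef0.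
congr [set w | _]; apply/funext => w; rewrite /S /=; congr (_ = 0).
congr (int_mpoly_eval f _); apply/funext => j; rewrite /v /=.
by case: eqP => [->|].
Qed.

End independent_padics.

(** * Countable intersection over all index tuples and polynomials *)

Theorem lemma3p2 (p : nat) (p_prime : prime p)
    (d : measure_display) (T : measurableType d) (R : realType)
    (P : probability T R) (xi : nat -> {RV P >-> padic_int p})
    (xi_indep : mutually_independent xi)
    (xi_atomless : forall (n : nat) (lambda : padic_int p),
       P (xi n @^-1` [set lambda]) = 0%E) :
  let E := [set w : T | algebraically_independent (fun n : nat => xi n w)] in
  measurable E /\ P E = 1%E.
Proof.
rewrite /algebraically_independent /=.
apply: (almost_sure_forall (A := fun k => [set w | forall i f, _])
   (e := id)) => // k.
(* A tuple of indices is coded through its finite function, which is a countable type. *)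
apply: (almost_sure_forall (A := fun i => [set w | forall f, _])
   (e := fun i : 'I_k -> nat => pickle [ffun j => i j])).
  move=> i j /(pcan_inj pickleK) /ffunP ij; apply/funext => a.
  by have := ij a; rewrite !ffunE.
move=> i; apply: (almost_sure_forall (A := fun f => [set w | _])
   (e := fun f : mpoly k int => pickle [seq (m, mcoeff m f) | m <- msupp f])).
  by move=> f g /(pcan_inj pickleK)/mpoly_graph_inj.
move=> f; do 3!apply: almost_sure_imp => ?.
rewrite [X in almost_sure _ X](_ : _ =
    ~` [set w | int_mpoly_eval f (fun j => xi (i j) w) = 0]).
  by apply: almost_sureC; [exact: measurable_eval_eq0|exact: null_eval].
by apply/seteqP; split=> w /= /eqP.
Qed.
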